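(* Let $\{u_i\otimes v_i\}_{i=1}^5$ be an orthonormal unextendible product basis in $\mathbb{C}^3\otimes\mathbb{C}^3$, and let $\Phi:\mathcal{L}(\mathbb{C}^3)\to\mathcal{L}(\mathbb{C}^3)$ be the linear map whose Choi matrix is $$C_\Phi=I-\sum_{i=1}^5 (u_i\otimes v_i)(u_i\otimes v_i)^*.$$ Then the mapping cone $\mathcal{M}_{\{\Phi\}}$ generated by $\Phi$ is untypical.
   Context: An (orthogonal) unextendible product basis (UPB) in $\mathbb{C}^m\otimes\mathbb{C}^n$ is a set of mutually orthogonal nonzero product vectors $\{u_i\otimes v_i\}_{i=1}^k$, $k\le mn$, such that there is no further nonzero product vector orthogonal to all of them; it is orthonormal if all $u_i\otimes v_i$ are normalized. For a linear map $\Phi:\mathcal{L}(\mathbb{C}^3)\to\mathcal{L}(\mathbb{C}^3)$, with $e_1,e_2,e_3$ the standard basis, the Choi matrix is $C_\Phi:=\sum_{i,j=1}^3 e_ie_j^*\otimes\Phi(e_ie_j^* )$; $\Phi\mapsto C_\Phi$ is a linear bijection (the Jamiołkowski–Choi isomorphism). Let $t$ be the transpose map on $\mathcal{L}(\mathbb{C}^3)$. A linear map $\Phi$ is positive if $\Phi(X)\ge 0$ whenever $X\ge 0$ (positive semidefinite), $k$-positive if $id_k\otimes\Phi$ is positive ($id_k$ the identity map on the $k\times k$ matrices), and completely positive if it is $k$-positive for all $k$. $\mathcal{P}_k$ and $\mathcal{CP}=\mathcal{P}_3$ denote the cones of $k$-positive and completely positive maps on $\mathcal{L}(\mathbb{C}^3)$.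 With ${\rm Ad}_A(X)=AXA^*$, $\mathcal{SP}_k$ is the cone of $k$-superpositive maps: finite sums $\sum_i{\rm Ad}_{A_i}$ with ${\rm rank}(A_i)\le k$ for all $i$. For a set $\mathcal{Q}$ of positive maps, the convex mapping cone generated by $\mathcal{Q}$ is $\mathcal{M}_{\mathcal{Q}}:=\{\sum_i\Phi_i\circ\Omega_i\circ\Psi_i:\Omega_i\in\mathcal{Q},\ \Phi_i,\Psi_i\in\mathcal{CP}\ \forall i\}$ (finite sums). A cone of positive maps on $\mathcal{L}(\mathbb{C}^3)$ is called typical if it can be obtained from the cones $\mathcal{P}_k$ and $\mathcal{SP}_k$ ($1\le k\le 3$) by finitely many applications of the operations $\mathcal{M}\mapsto\mathcal{M}\circ t:=\{\Phi\circ t:\Phi\in\mathcal{M}\}$, $(\mathcal{M}_1,\mathcal{M}_2)\mapsto\mathcal{M}_1\cap\mathcal{M}_2$, and $(\mathcal{M}_1,\mathcal{M}_2)\mapsto\mathcal{M}_1\vee\mathcal{M}_2:=\{\Phi+\Psi:\Phi\in\mathcal{M}_1,\Psi\in\mathcal{M}_2\}$; it is untypical if it is not typical. *)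

(* Defs.v *)
(* The complex numbers are R[i] for an arbitrary R : realType, vectors of C^n
   are column vectors, and linear maps on L(C^3) are elements of
   'End('M[R[i]]_3). *)
From HB Require Import structures.
From mathcomp Require Import all_boot all_order all_algebra.
From mathcomp Require Import classical_sets reals.
From mathcomp.real_closed Require Import complex mxtens.

Set Implicit Arguments.
Unset Strict Implicit.
Unset Printing Implicit Defensive.

Import Order.TTheory GRing.Theory Num.Theory.

Local Open Scope classical_set_scope.
Local Open Scope ring_scope.
Local Open Scope complex_scope.
Local Open Scope sesquilinear_scope.

Section Vectors.
Variable R : realType.
Local Notation C := R[i].

Definition dotc n (x y : 'cV[C]_n) : C := (x ^t* *m y) 0 0.

(* The width of [x *t y] is 1 * 1, which is convertible to 1. *)
Definition tensv m n (x : 'cV[C]_m) (y : 'cV[C]_n) : 'cV[C]_(m * n) := x *t y.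

Definition is_UPB m n k (u : 'I_k -> 'cV[C]_m) (v : 'I_k -> 'cV[C]_n) : Prop :=
  [/\ (k <= m * n)%N,
      forall i, tensv (u i) (v i) != 0,
      forall i j, i != j -> dotc (tensv (u i) (v i)) (tensv (u j) (v j)) = 0 &
      ~ exists (x : 'cV[C]_m) (y : 'cV[C]_n), tensv x y != 0 /\
          forall i, dotc (tensv (u i) (v i)) (tensv x y) = 0].

Definition is_orthonormal_UPB m n k
    (u : 'I_k -> 'cV[C]_m) (v : 'I_k -> 'cV[C]_n) : Prop :=
  is_UPB u v /\ forall i, dotc (tensv (u i) (v i)) (tensv (u i) (v i)) = 1.

(* The order on R[i] makes [0 <= z] entail that z is real; over the complex
   numbers this therefore forces X to be Hermitian. *)
Definition psd n (X : 'M[C]_n) : Prop := forall x : 'cV[C]_n, 0 <= dotc x (X *m x).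

End Vectors.

Section Maps.
Variable R : realType.
Local Notation C := R[i].
Local Notation L3 := 'M[C]_3.
Local Notation Maps := 'End('M[C]_3).

Definition choi (Phi : Maps) : 'M[C]_(3 * 3) :=
  \sum_(i < 3) \sum_(j < 3) delta_mx i j *t Phi (delta_mx i j).

Definition mxtens_block k (X : 'M[C]_(k * 3)) (i j : 'I_k) : L3 :=
  \matrix_(a, b) X (mxtens_index (i, a)) (mxtens_index (j, b)).

(* id_k (x) Phi, blockwise: [id_tensE] and [id_tens_is_linear] characterize it. *)
Definition id_tens k (Phi : Maps) (X : 'M[C]_(k * 3)) : 'M[C]_(k * 3) :=
  \sum_(i < k) \sum_(j < k) delta_mx i j *t Phi (mxtens_block X i j).

Definition positive_map (Phi : Maps) : Prop := forall X : L3, psd X -> psd (Phi X).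

Definition k_positive k (Phi : Maps) : Prop :=
  forall X : 'M[C]_(k * 3), psd X -> psd (id_tens Phi X).

Definition completely_positive (Phi : Maps) : Prop :=
  forall k, (0 < k)%N -> k_positive k Phi.

Definition transpose_map : Maps := linfun (@trmx C 3 3).

Definition Ad (A : L3) : Maps := linfun (mulmxr (A ^t* ) \o mulmx A).

Definition P_cone k : set Maps := [set Phi | k_positive k Phi].

Definition SP_cone k : set Maps :=
  [set Phi | exists n (A : 'I_n -> L3),
     (forall i, (\rank (A i) <= k)%N) /\ Phi = \sum_(i < n) Ad (A i)].

Definition mapping_cone (Q : set Maps) : set Maps :=
  [set Theta | exists n (Phi Omega Psi : 'I_n -> Maps),
     (forall i, [/\ completely_positive (Phi i), Q (Omega i) &
                    completely_positive (Psi i)]) /\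
     Theta = \sum_(i < n) (Phi i \o Omega i \o Psi i)%VF].

Definition compose_transpose (M : set Maps) : set Maps :=
  [set (Phi \o transpose_map)%VF | Phi in M].

Definition join_cone (M1 M2 : set Maps) : set Maps :=
  [set Phi + Psi | Phi in M1 & Psi in M2].

Inductive typical : set Maps -> Prop :=
| typical_P k : (1 <= k <= 3)%N -> typical (P_cone k)
| typical_SP k : (1 <= k <= 3)%N -> typical (SP_cone k)
| typical_transpose M : typical M -> typical (compose_transpose M)
| typical_meet M1 M2 : typical M1 -> typical M2 -> typical (M1 `&` M2)
| typical_join M1 M2 : typical M1 -> typical M2 -> typical (join_cone M1 M2).

Definition cone_of_positive_maps (M : set Maps) : Prop :=
  (forall Phi, M Phi -> positive_map Phi) /\
  (forall (c : C) Phi, 0 <= c -> M Phi -> M (c *: Phi)).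

(* (Un)typicality is a property of cones of positive maps. Every [typical] set
   is such a cone, but a set that is not [typical] need not be one. *)
Definition untypical (M : set Maps) : Prop :=
  cone_of_positive_maps M /\ ~ typical M.

Lemma transpose_mapE X : transpose_map X = X^T.
Proof. by rewrite lfunE. Qed.

Lemma AdE A X : Ad A X = A *m X *m A ^t*.
Proof. by rewrite lfunE. Qed.

Lemma id_tens_is_linear k (Phi : Maps) : linear (@id_tens k Phi).
Proof.
move=> c X Y; rewrite /id_tens scaler_sumr -big_split; apply: eq_bigr => i _ /=.
rewrite scaler_sumr -big_split; apply: eq_bigr => j _ /=.
have -> : mxtens_block (c *: X + Y) i j
  = c *: mxtens_block X i j + mxtens_block Y i j.
  by apply/matrixP => a b; rewrite !mxE.
rewrite linearP; apply/matrixP => a b; rewrite !mxE.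
by rewrite mulrDr mulrCA.
Qed.

Lemma id_tensE k (Phi : Maps) (A : 'M[C]_k) (B : L3) :
  id_tens Phi (A *t B) = A *t Phi B.
Proof.
have blk i j : mxtens_block (A *t B) i j = A i j *: B.
  by apply/matrixP => a b; rewrite !mxE !mxtens_indexK.
apply/matrixP => p q; rewrite /id_tens summxE.
under eq_bigr => i _ do (rewrite summxE;
  under eq_bigr => j _ do rewrite blk linearZ !mxE).
rewrite (bigD1 (mxtens_unindex p).1) //= (bigD1 (mxtens_unindex q).1) //=.
rewrite !eqxx mul1r !big1 ?addr0 ?mxE // => [i ne | j ne].
  by apply: big1 => j _; rewrite eq_sym (negPf ne) mul0r.
by rewrite [_ == j]eq_sym (negPf ne) andbF mul0r.
Qed.

End Maps.

(* Main.v *)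
From HB Require Import structures.
Require Import Defs.
From mathcomp Require Import all_boot all_order all_algebra.
From mathcomp Require Import classical_sets reals.
From mathcomp.real_closed Require Import complex mxtens.
From mathcomp Require Import ring.

Set Implicit Arguments.
Unset Strict Implicit.
Unset Printing Implicit Defensive.

Import Order.TTheory GRing.Theory Num.Theory.

Local Open Scope classical_set_scope.
Local Open Scope ring_scope.
Local Open Scope complex_scope.
Local Open Scope sesquilinear_scope.

(* Every typical cone M contains SP_1, and by induction on its construction
   either M = SP_1 or M contains any fixed map Omega such that Omega lies in
   SP_2 and Omega o t = Omega.  The cone generated by Phi contains Phi, which is
   not in SP_1: its Choi matrix annihilates the product basis, so a rank-one
   Kraus operator would give a product vector orthogonal to it.  It remains to
   choose Omega outside the cone generated by Phi.  We take Omega spanning an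
   extreme ray of the cone of maps Theta with Theta and Theta o t completely
   positive, with Choi matrix of rank 5.  If Omega is a sum of maps
   F o Phi o H with F, H completely positive, then expanding F and H into Kraus
   operators makes Omega a multiple of some Ad_A o Phi o Ad_B, whose Choi matrix
   has rank at most 9 - 5 = 4. *)

(** * Positive semidefinite matrices: hermitian, Gram factorization, kernel *)

Section PositiveSemidefinite.
Variable R : realType.
Local Notation C := R[i].

Lemma adjmx_mul m n p (A : 'M[C]_(m, n)) (B : 'M[C]_(n, p)) :
  (A *m B) ^t* = B ^t* *m A ^t*.
Proof. by rewrite trmx_mul map_mxM. Qed.

Lemma dotcE n (x y : 'cV[C]_n) : dotc x y = \sum_i ((x i 0)^*)%R * y i 0.
Proof. by rewrite /dotc mxE; apply: eq_bigr => i _; rewrite !mxE. Qed.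

Lemma dotc_ge0 n (x : 'cV[C]_n) : 0 <= dotc x x.
Proof.
by rewrite dotcE sumr_ge0 // => i _; rewrite mulrC -normCK exprn_ge0.
Qed.

Lemma dotc_eq0 n (x : 'cV[C]_n) : dotc x x = 0 -> x = 0.
Proof.
move=> x0; apply/colP => i; rewrite mxE.
move: x0; rewrite dotcE => /psumr_eq0P H.
apply/eqP; rewrite -normr_eq0 -sqrf_eq0 normCK mulrC H //.
by move=> j _; rewrite mulrC -normCK exprn_ge0.
Qed.

Lemma dotc_adj m n (A : 'M[C]_(m, n)) x y : dotc x (A *m y) = dotc (A ^t* *m x) y.
Proof. by rewrite /dotc adjmx_mul trmxCK mulmxA. Qed.

Lemma dotc_conj n (x y : 'cV[C]_n) : dotc x y = ((dotc y x)^*)%R.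
Proof.
rewrite !dotcE rmorph_sum; apply: eq_bigr => i _.
by rewrite rmorphM /= mulrC; congr (_ * _); rewrite conjCK.
Qed.

Lemma dotcDl n (x y z : 'cV[C]_n) : dotc (x + y) z = dotc x z + dotc y z.
Proof. by rewrite /dotc raddfD map_mxD mulmxDl mxE. Qed.

Lemma dotcDr n (x y z : 'cV[C]_n) : dotc x (y + z) = dotc x y + dotc x z.
Proof. by rewrite /dotc mulmxDr mxE. Qed.

Lemma dotcZl n (c : C) (x y : 'cV[C]_n) : dotc (c *: x) y = (c^*)%R * dotc x y.
Proof. by rewrite /dotc linearZ map_mxZ -scalemxAl mxE. Qed.

Lemma dotcZr n (c : C) (x y : 'cV[C]_n) : dotc x (c *: y) = c * dotc x y.
Proof. by rewrite /dotc -scalemxAr mxE. Qed.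

Lemma dotc_sumr n (I : finType) (x : 'cV[C]_n) (y : I -> 'cV[C]_n) :
  dotc x (\sum_i y i) = \sum_i dotc x (y i).
Proof. by rewrite /dotc mulmx_sumr summxE. Qed.

Lemma psdD n (X Y : 'M[C]_n) : psd X -> psd Y -> psd (X + Y).
Proof.
by move=> pX pY x; rewrite mulmxDl dotcDr addr_ge0 ?pX ?pY.
Qed.

Lemma psd0 n : psd (0 : 'M[C]_n).
Proof. by move=> x; rewrite mul0mx /dotc mulmx0 mxE. Qed.

Lemma psdZ n (c : C) (X : 'M[C]_n) : 0 <= c -> psd X -> psd (c *: X).
Proof.
by move=> c0 pX x; rewrite -scalemxAl dotcZr mulr_ge0 ?pX.
Qed.

Lemma psd_conj m n (A : 'M[C]_(m, n)) (X : 'M[C]_n) :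
  psd X -> psd (A *m X *m A ^t* ).
Proof. by move=> pX x; rewrite -!mulmxA dotc_adj pX. Qed.

Lemma psd_gram m n (V : 'M[C]_(m, n)) : psd (V *m V ^t* ).
Proof. by move=> x; rewrite -mulmxA dotc_adj dotc_ge0. Qed.

(** The quadratic form of [X] is real, so that of the difference of [X] and its adjoint vanishes
    identically. Polarizing with y and with iy then kills the sesquilinear form itself. *)
Lemma psd_hermitian n (X : 'M[C]_n) : psd X -> X ^t* = X.
Proof.
move=> pX.
have re x : dotc x (X *m x) = dotc x (X ^t* *m x).
  by rewrite [RHS]dotc_adj trmxCK [RHS]dotc_conj; apply/esym/CrealP/ger0_real/pX.
have quad x : dotc x ((X - X ^t* ) *m x) = 0.
  by rewrite mulmxBl dotcDr -scaleN1r dotcZr mulN1r re subrr.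
set D := X - X ^t* in quad.
have pol (x y : 'cV[C]_n) : dotc x (D *m y) = 0.
  have addq (z : 'cV[C]_n) : dotc x (D *m z) + dotc z (D *m x) = 0.
    have := quad (x + z).
    by rewrite mulmxDr dotcDl !dotcDr !quad add0r addr0 addrC.
  have s1 := addq y; have := addq ('i%C *: y).
  rewrite -scalemxAr dotcZl dotcZr.
  have -> : (('i%C : C)^*)%R = - 'i%C.
    by apply/eqP; rewrite eq_complex /= oppr0 !eqxx.
  rewrite mulNr -mulrBr => /eqP; rewrite mulf_eq0 => /orP[|].
    by rewrite eq_complex /= oner_eq0 andbF.
  rewrite subr_eq0 => /eqP ab; move: s1; rewrite -ab -mulr2n => /eqP.
  by rewrite mulrn_eq0 /= => /eqP.
have D0 : D = 0.
  apply/matrixP => i j; rewrite mxE.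
  have := pol (delta_mx i 0) (delta_mx j 0).
  rewrite -colE /dotc trmx_delta map_delta_mx -rowE !mxE //.
by move/eqP: D0; rewrite subr_eq0 eq_sym => /eqP.
Qed.

(** Diagonalize by a unitary [P]. The eigenvalues are values of the quadratic form, hence
    nonnegative, and their square roots can be split between the two factors. *)
Lemma psd_factor n (X : 'M[C]_n) : psd X -> exists V : 'M[C]_n, X = V *m V ^t*.
Proof.
move=> pX.
have Xn : X \is normalmx.
  by apply/hermitian_normalmx/is_hermitianmxP; rewrite expr0 scale1r psd_hermitian.
have := orthomx_spectralP Xn; set P := spectralmx X; set d := spectral_diag X.
have uP : P \is unitarymx by exact: spectral_unitarymx.
rewrite /= invmx_unitary // => XE.
have PX : P *m X *m P ^t* = diag_mx d.
  by rewrite XE !mulmxA (unitarymxP uP) mul1mx mulmxtVK.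
have d0 i : 0 <= d 0 i.
  have := psd_conj P pX (delta_mx i 0); rewrite PX -colE /dotc.
  by rewrite trmx_delta map_delta_mx -rowE !mxE eqxx.
exists (P ^t* *m diag_mx (map_mx sqrtC d)).
rewrite adjmx_mul trmxCK mulmxA -(mulmxA (P ^t* )) {1}XE; congr (_ *m _ *m _).
rewrite tr_diag_mx map_diag_mx mulmx_diag; congr diag_mx.
apply/rowP => i; rewrite !mxE /=.
by rewrite (CrealP (ger0_real _)) ?sqrtC_ge0 // -expr2 sqrtCK.
Qed.

Lemma psd_ker n (X : 'M[C]_n) (w : 'cV[C]_n) :
  psd X -> dotc w (X *m w) = 0 -> X *m w = 0.
Proof.
move=> /psd_factor[V ->]; rewrite -mulmxA dotc_adj => /dotc_eq0 ->.
by rewrite mulmx0.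
Qed.

End PositiveSemidefinite.

(** * Choi matrices, Kraus decompositions and complete positivity *)

Section Maps.
Variable R : realType.
Local Notation C := R[i].
Local Notation Maps := 'End('M[C]_3).
Implicit Types (Theta : Maps) (A B : 'M[C]_3).

Lemma mxtens_eqP m n (M N : 'M[C]_(m * n)) :
  (forall i a j b, M (mxtens_index (i, a)) (mxtens_index (j, b))
                   = N (mxtens_index (i, a)) (mxtens_index (j, b))) -> M = N.
Proof.
move=> E; apply/matrixP => p q; rewrite -(mxtens_unindexK p) -(mxtens_unindexK q).
by case: (mxtens_unindex p) (mxtens_unindex q) => i a [j b].
Qed.

(* The vector [A_{ai}] at [e_i (x) e_a], so that [choi (Ad A)] is its dyad. *)
Definition vecm A : 'cV[C]_(3 * 3) :=
  \col_p A (mxtens_unindex p).2 (mxtens_unindex p).1.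

Lemma vecmE A i a : vecm A (mxtens_index (i, a)) 0 = A a i.
Proof. by rewrite mxE mxtens_indexK. Qed.

Lemma choiE Theta i a j b :
  choi Theta (mxtens_index (i, a)) (mxtens_index (j, b))
  = Theta (delta_mx i j) a b.
Proof.
rewrite /choi summxE (bigD1 i) //= summxE (bigD1 j) //= tensmxE mxE !eqxx mul1r.
rewrite !big1 ?addr0 // => [k ki | k kj].
  by rewrite summxE big1 // => l _; rewrite tensmxE mxE eq_sym (negPf ki) mul0r.
by rewrite tensmxE mxE [j == _]eq_sym (negPf kj) andbF mul0r.
Qed.

Lemma map_eqP Theta Theta' :
  (forall i j, Theta (delta_mx i j) = Theta' (delta_mx i j)) -> Theta = Theta'.
Proof.
move=> E; apply/lfunP => X; rewrite (matrix_sum_delta X) !linear_sum.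
apply: eq_bigr => i _; rewrite !linear_sum; apply: eq_bigr => j _.
by rewrite !linearZ /= E.
Qed.

Lemma choi_inj : injective (@choi R).
Proof.
move=> T T' E; apply: map_eqP => i j; apply/matrixP => a b.
by rewrite -!choiE E.
Qed.

Lemma choi_is_linear : linear (@choi R).
Proof.
move=> c T T'; apply: mxtens_eqP => i a j b.
by rewrite !mxE !choiE !(add_lfunE, scale_lfunE) !mxE.
Qed.

HB.instance Definition _ :=
  GRing.isLinear.Build C Maps 'M[C]_(3 * 3) _ (@choi R) choi_is_linear.

Lemma Ad_delta A i j a b :
  Ad A (delta_mx i j) a b = A a i * ((A b j)^*)%R.
Proof.
rewrite AdE -(mul_delta_mx (0 : 'I_1)) mulmxA -colE -mulmxA -rowE mxE.
by rewrite big_ord1 !mxE.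
Qed.

Lemma choi_Ad A : choi (Ad A) = vecm A *m (vecm A) ^t*.
Proof.
apply: mxtens_eqP => i a j b.
by rewrite choiE Ad_delta mxE big_ord1 !mxE !mxtens_indexK.
Qed.

(** Each column of a Gram factor of the Choi matrix, reshaped to a 3 x 3 matrix, is a Kraus
    operator. *)
Lemma kraus Theta :
  psd (choi Theta) -> exists n (A : 'I_n -> 'M[C]_3), Theta = \sum_i Ad (A i).
Proof.
case/psd_factor => V VE.
exists (3 * 3)%N, (fun k => \matrix_(a, i) V (mxtens_index (i, a)) k).
apply: choi_inj; rewrite linear_sum VE; apply: mxtens_eqP => i a j b /=.
rewrite mxE summxE; apply: eq_bigr => k _.
by rewrite choiE Ad_delta !mxE.
Qed.

Lemma id_tensD k Theta Theta' (X : 'M[C]_(k * 3)) :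
  id_tens (Theta + Theta') X = id_tens Theta X + id_tens Theta' X.
Proof.
rewrite /id_tens -big_split; apply: eq_bigr => i _ /=.
rewrite -big_split; apply: eq_bigr => j _ /=.
by rewrite add_lfunE; apply/matrixP => p q; rewrite !mxE mulrDr.
Qed.

Lemma id_tensZ k c Theta (X : 'M[C]_(k * 3)) :
  id_tens (c *: Theta) X = c *: id_tens Theta X.
Proof.
rewrite /id_tens scaler_sumr; apply: eq_bigr => i _ /=.
rewrite scaler_sumr; apply: eq_bigr => j _ /=.
by rewrite scale_lfunE; apply/matrixP => p q; rewrite !mxE mulrCA.
Qed.

Lemma id_tens0 k (X : 'M[C]_(k * 3)) : id_tens (0 : Maps) X = 0.
Proof. by rewrite -(scale0r (0 : Maps)) id_tensZ scale0r. Qed.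

Lemma id_tensEmx k Theta (X : 'M[C]_(k * 3)) i a j b :
  id_tens Theta X (mxtens_index (i, a)) (mxtens_index (j, b))
  = Theta (mxtens_block X i j) a b.
Proof.
rewrite /id_tens summxE (bigD1 i) //= summxE (bigD1 j) //= tensmxE mxE !eqxx.
rewrite mul1r !big1 ?addr0 // => [l li | l lj].
  by rewrite summxE big1 // => m _; rewrite tensmxE mxE eq_sym (negPf li) mul0r.
by rewrite tensmxE mxE [j == _]eq_sym (negPf lj) andbF mul0r.
Qed.

Lemma sum_mxtens_index m n (F : 'I_(m * n) -> C) :
  \sum_p F p = \sum_(i < m) \sum_(a < n) F (mxtens_index (i, a)).
Proof.
rewrite pair_big; apply: reindex => /=.
exists (@mxtens_unindex m n) => p _; last by rewrite mxtens_unindexK.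
by case: p => i a; rewrite mxtens_indexK.
Qed.

Lemma id_tens_Ad k A (X : 'M[C]_(k * 3)) :
  id_tens (Ad A) X = (1%:M *t A) *m X *m (1%:M *t A) ^t*.
Proof.
apply: mxtens_eqP => i a j b.
rewrite id_tensEmx AdE !mxE sum_mxtens_index (bigD1 j) //= [X in _ + X]big1.
  rewrite addr0; apply: eq_bigr => d _; rewrite !mxE !mxtens_indexK eqxx mul1r.
  congr (_ * _); rewrite sum_mxtens_index (bigD1 i) //= [X in _ + X]big1.
    by rewrite addr0; apply: eq_bigr => c _; rewrite tensmxE !mxE eqxx mul1r.
  move=> l li; apply: big1 => c _.
  by rewrite tensmxE mxE eq_sym (negPf li) !mul0r.
move=> l lj; apply: big1 => d _.
by rewrite !mxE !mxtens_indexK eq_sym (negPf lj) mul0r rmorph0 mulr0.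
Qed.

Lemma k_positiveD k Theta Theta' :
  k_positive k Theta -> k_positive k Theta' -> k_positive k (Theta + Theta').
Proof. by move=> P P' X pX; rewrite id_tensD; apply: psdD; auto. Qed.

Lemma k_positiveZ k c Theta :
  0 <= c -> k_positive k Theta -> k_positive k (c *: Theta).
Proof. by move=> c0 P X pX; rewrite id_tensZ; apply: psdZ; auto. Qed.

Lemma k_positive_Ad k A : k_positive k (Ad A).
Proof. by move=> X pX; rewrite id_tens_Ad; apply: psd_conj. Qed.

Lemma k_positive_sum_Ad k n (A : 'I_n -> 'M[C]_3) : k_positive k (\sum_i Ad (A i)).
Proof.
elim/big_ind: _ => [X _| |i _].
- by rewrite id_tens0; apply: psd0.
- exact: k_positiveD.
- exact: k_positive_Ad.
Qed.

(** The Choi matrix is the image under id_3 tensor [Theta] of the dyad of the maximally entangled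
    vector [vecm 1], so 3-positivity suffices. *)
Lemma psd_choi Theta : completely_positive Theta -> psd (choi Theta).
Proof.
move=> /(_ 3 isT); pose W := vecm 1%:M.
move=> /(_ (W *m W ^t* ) (psd_gram _)); congr psd.
apply: mxtens_eqP => i a j b.
rewrite id_tensEmx choiE; congr (fun_of_matrix (Theta _) a b).
apply/matrixP => c d; rewrite !mxE big_ord1 !mxE !mxtens_indexK /=.
by rewrite conjC_nat -natrM mulnb.
Qed.

Lemma cp_kraus Theta :
  completely_positive Theta ->
  exists n (A : 'I_n -> 'M[C]_3), Theta = \sum_i Ad (A i).
Proof. by move=> /psd_choi/kraus. Qed.

Lemma positive_map_Ad A : positive_map (Ad A).
Proof. by move=> X pX; rewrite AdE; apply: psd_conj. Qed.

Lemma positive_mapD Theta Theta' :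
  positive_map Theta -> positive_map Theta' -> positive_map (Theta + Theta').
Proof. by move=> P P' X pX; rewrite add_lfunE; apply: psdD; auto. Qed.

Lemma positive_map_sum n (Theta : 'I_n -> Maps) :
  (forall i, positive_map (Theta i)) -> positive_map (\sum_i Theta i).
Proof.
move=> P; elim/big_ind: _ => // [X _|T T' PT PT']; last exact: positive_mapD.
by rewrite zero_lfunE; apply: psd0.
Qed.

Lemma cp_positive Theta : completely_positive Theta -> positive_map Theta.
Proof.
by move=> /cp_kraus[n [A ->]]; apply: positive_map_sum => i; apply: positive_map_Ad.
Qed.

End Maps.

(** * Closure properties of the completely positive, PPT and superpositive cones *)

Section Cones.
Variable R : realType.
Local Notation C := R[i].
Local Notation Maps := 'End('M[C]_3).
Implicit Types (Theta Psi : Maps) (A B : 'M[C]_3).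
Local Notation t := (transpose_map R).

Lemma cp_choi Theta : psd (choi Theta) -> completely_positive Theta.
Proof. by move=> /kraus[n [A ->]] k _; apply: k_positive_sum_Ad. Qed.

Lemma cpD Theta Psi :
  completely_positive Theta -> completely_positive Psi ->
  completely_positive (Theta + Psi).
Proof. by move=> pT pP k k0; apply: k_positiveD; auto. Qed.

Lemma cp_Ad A : completely_positive (Ad A).
Proof. by move=> k _; apply: k_positive_Ad. Qed.

Lemma cp_sum n (Theta : 'I_n -> Maps) :
  (forall i, completely_positive (Theta i)) -> completely_positive (\sum_i Theta i).
Proof.
move=> P; elim/big_ind: _ => [k _ X _|T T'|i _]; last exact: P.
  by rewrite id_tens0; apply: psd0.
exact: cpD.
Qed.

Lemma cp_id : completely_positive (\1%VF : Maps).
Proof.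
have -> : \1%VF = Ad (1%:M : 'M[C]_3); last exact: cp_Ad.
by apply/lfunP => X; rewrite AdE id_lfunE trmx1 map_mx1 mul1mx mulmx1.
Qed.

Lemma id_tens_comp k Theta Psi (X : 'M[C]_(k * 3)) :
  id_tens (Theta \o Psi)%VF X = id_tens Theta (id_tens Psi X).
Proof.
apply: mxtens_eqP => i a j b; rewrite !id_tensEmx comp_lfunE.
congr (fun_of_matrix (Theta _) a b).
by apply/matrixP => c d; rewrite [RHS]mxE id_tensEmx.
Qed.

Lemma cp_comp Theta Psi :
  completely_positive Theta -> completely_positive Psi ->
  completely_positive (Theta \o Psi)%VF.
Proof. by move=> pT pP k k0 X pX; rewrite id_tens_comp; apply: pT => //; apply: pP. Qed.

Lemma transpose_mapK : (t \o t)%VF = \1%VF.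
Proof. by apply/lfunP => X; rewrite comp_lfunE !transpose_mapE trmxK id_lfunE. Qed.

Lemma transpose_Ad A : (t \o Ad A)%VF = (Ad (map_mx Num.conj A) \o t)%VF.
Proof.
apply/lfunP => X; rewrite !comp_lfunE !transpose_mapE !AdE !trmx_mul mulmxA.
congr (_ *m _ *m _); first by rewrite map_trmx trmxK.
by apply/matrixP => i j; rewrite !mxE conjCK.
Qed.

(** Conjugating by the transpose replaces every Kraus operator by its entrywise complex
    conjugate. *)
Lemma transpose_conj_cp Psi :
  completely_positive Psi -> completely_positive (t \o Psi \o t)%VF.
Proof.
move=> /cp_kraus[n [A ->]].
have -> : (t \o (\sum_i Ad (A i)) \o t)%VF = \sum_i Ad (map_mx Num.conj (A i)).
  apply/lfunP => X; rewrite !comp_lfunE !sum_lfunE linear_sum.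
  apply: eq_bigr => i _ /=.
  rewrite -[LHS](comp_lfunE t) transpose_Ad -[LHS](comp_lfunE _ t) -comp_lfunA.
  by rewrite transpose_mapK comp_lfun1r.
by apply: cp_sum => i; apply: cp_Ad.
Qed.

(** Equivalently, the Choi matrix and its partial transpose are both positive semidefinite. *)
Definition ppt Theta : Prop :=
  completely_positive Theta /\ completely_positive (Theta \o t)%VF.

(** The transpose is moved past [Psi] by inserting t o t = 1, which leaves the completely positive
    map t o Psi o t on the right of [Theta \o t]. *)
Lemma ppt_comp Phi Theta Psi :
  completely_positive Phi -> ppt Theta -> completely_positive Psi ->
  ppt (Phi \o Theta \o Psi)%VF.
Proof.
move=> pPhi [pT pTt] pPsi; split; first exact: cp_comp (cp_comp pPhi pT) pPsi.
rewrite -!comp_lfunA.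
have -> : (Psi \o t = t \o (t \o Psi \o t))%VF.
  by rewrite !comp_lfunA transpose_mapK comp_lfun1l.
rewrite (comp_lfunA Theta).
exact: cp_comp pPhi (cp_comp pTt (transpose_conj_cp pPsi)).
Qed.

Lemma SP_cone_Ad k A : (\rank A <= k)%N -> SP_cone k (Ad A).
Proof. by move=> rA; exists 1, (fun=> A); split=> //; rewrite big_ord1. Qed.

Lemma SP_cone0 k : SP_cone k (0 : Maps).
Proof. by exists 0, (fun=> 0); split=> [[]//|]; rewrite big_ord0. Qed.

Lemma SP_coneD k Theta Psi :
  SP_cone k Theta -> SP_cone k Psi -> SP_cone k (Theta + Psi).
Proof.
move=> [n [A [rA ->]]] [m [B [rB ->]]].
exists (n + m)%N, (fun i => match split i with inl j => A j | inr j => B j end).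
split=> [i|]; first by case: (split i).
rewrite big_split_ord; congr (_ + _); apply: eq_bigr => i _.
  by rewrite (unsplitK (inl i)).
by rewrite (unsplitK (inr i)).
Qed.

Lemma SP_cone_sum k n (Theta : 'I_n -> Maps) :
  (forall i, SP_cone k (Theta i)) -> SP_cone k (\sum_i Theta i).
Proof.
move=> P; elim/big_ind: _ => [|T T'|i _]; last exact: P.
  exact: SP_cone0.
exact: SP_coneD.
Qed.

Lemma SP_cone_le k l Theta : (k <= l)%N -> SP_cone k Theta -> SP_cone l Theta.
Proof.
by move=> kl [n [A [rA ->]]]; exists n, A; split=> // i; apply: leq_trans kl.
Qed.

Lemma SP_cone_cp k Theta : SP_cone k Theta -> completely_positive Theta.
Proof. by move=> [n [A [_ ->]]]; apply: cp_sum => i; apply: cp_Ad. Qed.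

(** Any nonzero vector of a row space of dimension one spans it. *)
Lemma rank_le1P (F : fieldType) m n (A : 'M[F]_(m, n)) :
  (\rank A <= 1)%N -> exists (x : 'cV_m) (y : 'rV_n), A = x *m y.
Proof.
have [->|A0] := eqVneq A 0; first by exists 0, 0; rewrite mul0mx.
have /rowV0Pn[y yA y0] : A != 0 by [].
move=> rA; have : (A <= y)%MS.
  by rewrite -(mxrank_leqif_sup yA) eqn_leq mxrankS //= rank_rV y0.
by case/submxP => x ->; exists x, y.
Qed.

(** The left side is a 1 x 1 matrix, hence equal to its own transpose. *)
Lemma row_form_trmx n (y : 'rV[C]_n) (X : 'M[C]_n) :
  y *m X^T *m y ^t* = map_mx Num.conj y *m X *m (map_mx Num.conj y) ^t*.
Proof.
have tr11 (M : 'M[C]_1) : M^T = M by apply/matrixP => j l; rewrite mxE !ord1.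
have yK : (map_mx Num.conj y) ^t* = y^T.
  by apply/matrixP => j l; rewrite !mxE conjCK.
rewrite yK -(tr11 (_ *m y^T)) trmx_mul trmxK trmx_mul mulmxA.
by rewrite map_trmx.
Qed.

(** For a rank-one Kraus operator x y, composing with the transpose only conjugates the row y, so
    the rank stays at most one. *)
Lemma SP1_transpose Theta : SP_cone 1 Theta -> SP_cone 1 (Theta \o t)%VF.
Proof.
move=> [n [A [rA ->]]].
have -> : ((\sum_i Ad (A i)) \o t)%VF = \sum_i (Ad (A i) \o t)%VF.
  apply/lfunP => X; rewrite comp_lfunE !sum_lfunE.
  by apply: eq_bigr => i _; rewrite comp_lfunE.
apply: SP_cone_sum => i; have [x [y ->]] := rank_le1P (rA i).
have -> : (Ad (x *m y) \o t)%VF = Ad (x *m map_mx Num.conj y).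
  apply/lfunP => X; rewrite comp_lfunE transpose_mapE !AdE !adjmx_mul.
  have regroup (r : 'rV[C]_3) M (c : 'cV[C]_3) (s : 'rV[C]_3) :
      x *m r *m M *m (c *m s) = x *m (r *m M *m c) *m s by rewrite !mulmxA.
  by rewrite !regroup row_form_trmx.
apply: SP_cone_Ad; apply: leq_trans (mulmx_max_rank _ _) _; exact: leqnn.
Qed.

End Cones.

(** * The projection onto the orthogonal complement of an orthonormal family *)

Section OrthonormalFamily.
Variable R : realType.
Local Notation C := R[i].
Variables (n k : nat) (w : 'I_k -> 'cV[C]_n).
Hypothesis w_orth : forall i j, dotc (w i) (w j) = (i == j)%:R.

Let W : 'M[C]_(n, k) := \matrix_(i, j) w j i 0.
Let P : 'M[C]_n := 1%:M - \sum_i w i *m (w i) ^t*.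

Let WW : W ^t* *m W = 1%:M.
Proof.
apply/matrixP => i j; rewrite !mxE -w_orth dotcE.
by apply: eq_bigr => l _; rewrite !mxE.
Qed.

Let PE : P = 1%:M - W *m W ^t*.
Proof.
congr (_ - _); apply/matrixP => i j; rewrite summxE mxE.
by apply: eq_bigr => l _; rewrite !mxE big_ord1 !mxE.
Qed.

Let PW : P *m W = 0.
Proof. by rewrite PE mulmxBl mul1mx -mulmxA WW mulmx1 subrr. Qed.

Lemma proj_compl_psd : psd P.
Proof.
have Pt : P ^t* = P.
  rewrite PE raddfB /= map_mxB trmx1 map_mx1.
  by rewrite adjmx_mul trmxCK.
have -> : P = P *m P ^t*; last exact: psd_gram.
by rewrite Pt {3}PE mulmxBr mulmxA PW mul0mx subr0 mulmx1.
Qed.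

Lemma proj_compl_ker j : P *m w j = 0.
Proof.
have -> : w j = col j W by apply/colP => i; rewrite !mxE.
by rewrite colE mulmxA PW mul0mx.
Qed.

(** [P] annihilates [W], and [W] has full column rank because its Gram matrix is the identity. *)
Lemma proj_compl_rank : (\rank P + k <= n)%N.
Proof.
have <- : \rank W = k.
  apply/eqP; rewrite eqn_leq rank_leq_col /=.
  by have := mxrankM_maxr (W ^t* ) W; rewrite WW mxrank1.
exact: mulmx0_rank_max PW.
Qed.

Lemma proj_compl_neq0 : (k < n)%N -> P != 0.
Proof.
move=> kn; apply/negP => /eqP; rewrite PE => /eqP; rewrite subr_eq0 => /eqP E.
have := mxrankM_maxl W (W ^t* ); rewrite -E mxrank1 => /leq_trans.
by move=> /(_ _ (rank_leq_col W)); rewrite leqNgt kn.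
Qed.

End OrthonormalFamily.

(** * The map attached to an unextendible product basis *)

Section ProductBasis.
Variable R : realType.
Local Notation C := R[i].
Local Notation t := (transpose_map R).

Lemma tensvE m n (x : 'cV[C]_m) (y : 'cV[C]_n) i a :
  tensv x y (mxtens_index (i, a)) 0 = x i 0 * y a 0.
Proof. by rewrite /tensv mxE !mxtens_indexK /=; congr (x _ _ * y _ _); apply: val_inj. Qed.

Lemma dyadE n (x : 'cV[C]_n) p q :
  (x *m x ^t* ) p q = x p 0 * ((x q 0)^*)%R.
Proof. by rewrite mxE big_ord1 !mxE. Qed.

Lemma dotc_tensv m n (x x' : 'cV[C]_m) (y y' : 'cV[C]_n) :
  dotc (tensv x y) (tensv x' y') = dotc x x' * dotc y y'.
Proof.
rewrite !dotcE sum_mxtens_index mulr_suml; apply: eq_bigr => i _.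
rewrite mulr_sumr; apply: eq_bigr => a _.
by rewrite !tensvE rmorphM /= mulrACA.
Qed.

Lemma vecm_rank1 (x : 'cV[C]_3) (y : 'rV[C]_3) :
  vecm (x *m y) = tensv y^T x.
Proof.
apply/matrixP => p j; rewrite ord1 -(mxtens_unindexK p).
case: (mxtens_unindex p) => i a.
by rewrite vecmE tensvE mxE big_ord1 mxE mulrC.
Qed.

Variables (u v : 'I_5 -> 'cV[C]_3) (Phi : 'End('M[C]_3)).
Hypothesis huv : is_orthonormal_UPB u v.
Hypothesis hPhi : choi Phi =
  1%:M - \sum_(i < 5) tensv (u i) (v i) *m (tensv (u i) (v i)) ^t*.

Lemma upb_orth i j :
  dotc (tensv (u i) (v i)) (tensv (u j) (v j)) = (i == j)%:R.
Proof.
case: huv => [[_ _ orth _] nrm]; have [<-|/orth] := eqVneq i j; last by [].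
exact: nrm.
Qed.

(** Inner products of product vectors factor. Conjugating the first tensor factors swaps the
    arguments of one factor, which changes neither its vanishing nor the norms. *)
Lemma upb_conj_orth i j :
  dotc (tensv (map_mx Num.conj (u i)) (v i))
       (tensv (map_mx Num.conj (u j)) (v j)) = (i == j)%:R.
Proof.
have uC : dotc (map_mx Num.conj (u i)) (map_mx Num.conj (u j))
          = dotc (u j) (u i).
  by rewrite !dotcE; apply: eq_bigr => l _; rewrite !mxE conjCK mulrC.
rewrite dotc_tensv uC; have := upb_orth i j; rewrite dotc_tensv.
have [<-//|ne] := eqVneq i j; move/eqP; rewrite mulf_eq0 => /orP[]/eqP uv0.
  by rewrite dotc_conj uv0 rmorph0 mul0r.
by rewrite uv0 mulr0.
Qed.

(** Precomposing with the transpose is partial transposition of the Choi matrix in its first tensor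
    factor. *)
Lemma choi_transpose (Theta : 'End('M[C]_3)) i a j b :
  choi (Theta \o t)%VF (mxtens_index (i, a)) (mxtens_index (j, b))
  = choi Theta (mxtens_index (j, a)) (mxtens_index (i, b)).
Proof. by rewrite !choiE comp_lfunE transpose_mapE trmx_delta. Qed.

(** The partial transpose of the projection is again such a projection, for the product family whose
    first factors are conjugated. *)
Lemma upb_map_ppt : ppt Phi.
Proof.
split; apply: cp_choi; first by rewrite hPhi; apply/proj_compl_psd/upb_orth.
have -> : choi (Phi \o t)%VF = 1%:M - \sum_i
    tensv (map_mx Num.conj (u i)) (v i) *m
    (tensv (map_mx Num.conj (u i)) (v i)) ^t*.
  apply: mxtens_eqP => i a j b; rewrite choi_transpose hPhi.
  rewrite !(mxE, summxE); congr (_ - _).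
    by rewrite !(can_eq (@mxtens_indexK 3 3)) !xpair_eqE [i == j]eq_sym.
  apply: eq_bigr => l _; rewrite !dyadE !tensvE !mxE !rmorphM /= conjCK.
  by rewrite mulrACA [X in X * _]mulrC mulrACA.
exact/proj_compl_psd/upb_conj_orth.
Qed.

Lemma upb_map_rank : (\rank (choi Phi) <= 4)%N.
Proof.
have := proj_compl_rank upb_orth.
by rewrite -hPhi -[X in (_ <= X)%N]/(4 + 5)%N leq_add2r.
Qed.

(** Each basis vector is in the kernel of a sum of positive semidefinite dyads, so it is orthogonal
    to every [vecm (A k)]. These are product vectors, and unextendibility forces them to vanish. *)
Lemma upb_map_notin_SP1 : ~ SP_cone 1 Phi.
Proof.
move=> [n [A [rA PhiE]]].
have A0 k : A k = 0.
  have [x [y AE]] := rank_le1P (rA k).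
  case: huv => [[_ _ _ unext] _].
  have [/eqP xy0|xy0] := boolP (tensv y^T x == 0).
    apply/matrixP => a i; rewrite [RHS]mxE -vecmE AE vecm_rank1 xy0.
    by rewrite mxE.
  exfalso; apply: unext; exists y^T, x; split=> // i.
  set w := tensv _ _; have := proj_compl_ker upb_orth i; rewrite -hPhi -/w.
  move=> /(congr1 (dotc w)); rewrite PhiE linear_sum /= mulmx_suml dotc_sumr.
  rewrite [in RHS]/dotc mulmx0 mxE => /eqP.
  rewrite psumr_eq0 => [/allP/(_ k)|l _]; last first.
    by rewrite choi_Ad; apply: psd_gram.
  rewrite mem_index_enum => /(_ isT)/eqP.
  rewrite choi_Ad -mulmxA dotc_adj => /dotc_eq0/(congr1 (fun M : 'M_1 => M 0 0)).
  move=> Aw0; rewrite dotc_conj -vecm_rank1 -AE.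
  by rewrite /dotc Aw0 mxE rmorph0.
(* Five vectors do not span a space of dimension 9, so the projection is nonzero. *)
suff : choi Phi = 0 by apply/eqP; rewrite hPhi; apply: proj_compl_neq0.
rewrite PhiE big1 ?linear0 // => k _; rewrite A0.
by apply/lfunP => X; rewrite AdE !mul0mx zero_lfunE.
Qed.

End ProductBasis.

(** * The linear system behind extremality *)

Local Notation e1 := (@Ordinal 3 0 isT).
Local Notation e2 := (@Ordinal 3 1 isT).
Local Notation e3 := (@Ordinal 3 2 isT).

Lemma ord3P (P : 'I_3 -> Prop) : P e1 -> P e2 -> P e3 -> forall i, P i.
Proof.
move=> P1 P2 P3 [[|[|[|k]]] ki]; last by [].
- by rewrite (_ : Ordinal ki = e1) //; apply: val_inj.
- by rewrite (_ : Ordinal ki = e2) //; apply: val_inj.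
- by rewrite (_ : Ordinal ki = e3) //; apply: val_inj.
Qed.

Section Extremality.
Variables (F : numFieldType) (I : F).
Hypothesis II : I * I = -1.

(** With h i a j b the entry of a 9 x 9 matrix in row (i,a) and column (j,b), and J = i, these
    equations say that the matrix annihilates the four vectors given by [omega_ker1] to
    [omega_ker4]. *)
Definition col_rel (J : F) (h : 'I_3 -> 'I_3 -> 'I_3 -> 'I_3 -> F) : Prop :=
  forall i a,
  [/\ h i a e2 e1 = h i a e1 e2, h i a e3 e2 = h i a e2 e3,
      h i a e1 e3 = - J * h i a e3 e1 &
      h i a e3 e3 = (1 + J) * h i a e2 e2 - (1 + 2 * J) * h i a e1 e1].

(** [hc] and [hr] constrain the rows and columns of the matrix; [gc] and [gr] do the same for its
    partial transpose. The conjugate -I replaces I for columns. *)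
Variable h : 'I_3 -> 'I_3 -> 'I_3 -> 'I_3 -> F.
Hypothesis hc : col_rel I h.
Hypothesis hr : col_rel (- I) (fun i a j b => h j b i a).
Hypothesis gc : col_rel I (fun i a j b => h j a i b).
Hypothesis gr : col_rel (- I) (fun i a j b => h i b j a).

Let c1 i a : h i a e2 e1 = h i a e1 e2. Proof. by case: (hc i a). Qed.
Let c2 i a : h i a e3 e2 = h i a e2 e3. Proof. by case: (hc i a). Qed.
Let c3 i a : h i a e1 e3 = - I * h i a e3 e1. Proof. by case: (hc i a). Qed.
Let c4 i a : h i a e3 e3 = (1 + I) * h i a e2 e2 - (1 + 2 * I) * h i a e1 e1.
Proof. by case: (hc i a). Qed.
Let r1 i a : h e2 e1 i a = h e1 e2 i a. Proof. by case: (hr i a). Qed.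
Let r2 i a : h e3 e2 i a = h e2 e3 i a. Proof. by case: (hr i a). Qed.
Let r3 i a : h e1 e3 i a = I * h e3 e1 i a.
Proof. by case: (hr i a) => _ _ ->; rewrite opprK. Qed.
Let r4 i a : h e3 e3 i a = (1 - I) * h e2 e2 i a - (1 - 2 * I) * h e1 e1 i a.
Proof. by case: (hr i a) => _ _ _ ->; rewrite mulrN. Qed.
Let gc1 a k : h e2 a k e1 = h e1 a k e2. Proof. by case: (gc k a). Qed.
Let gc2 a k : h e3 a k e2 = h e2 a k e3. Proof. by case: (gc k a). Qed.
Let gc3 a k : h e1 a k e3 = - I * h e3 a k e1. Proof. by case: (gc k a). Qed.
Let gr1 k b : h k e1 e2 b = h k e2 e1 b. Proof. by case: (gr k b). Qed.
Let gr2 k b : h k e2 e3 b = h k e3 e2 b. Proof. by case: (gr k b). Qed.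
Let gr3 k b : h k e3 e1 b = I * h k e1 e3 b.
Proof. by case: (gr k b) => _ _ ->; rewrite opprK. Qed.

Let I0 : I != 0.
Proof.
apply: contraPneq II => ->; rewrite mul0r => /esym/eqP.
by rewrite oppr_eq0 oner_eq0.
Qed.

Let cancelI z : I * z = 0 -> z = 0.
Proof. by move/eqP; rewrite mulf_eq0 (negPf I0) => /eqP. Qed.

Let cancel2 z : (2 : F) * z = 0 -> z = 0.
Proof. by move/eqP; rewrite mulf_eq0 pnatr_eq0 => /eqP. Qed.

(** Reduces the vanishing of z to an identity for [ring]: z is exhibited as a combination of two
    known equations with coefficients k and l. *)
Let lin (k l a b c d z : F) :
  a = b -> c = d -> z = k * (a - b) + l * (c - d) -> z = 0.
Proof. by move=> -> -> ->; rewrite !subrr !mulr0 addr0. Qed.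

(* The equations are invariant under [D (x) D] for diagonal sign matrices [D],
   so they split into one block for each of the four sign characters. *)
Let block0 : h e1 e1 e1 e1 = 0 ->
  [/\ h e1 e1 e2 e2 = 0, h e2 e2 e1 e1 = 0, h e2 e2 e2 e2 = 0
    & [/\ h e1 e2 e1 e2 = 0, h e2 e3 e2 e3 = 0 & h e3 e1 e3 e1 = 0]].
Proof.
move=> z0.
have E1122 : h e1 e1 e2 e2 = h e1 e2 e1 e2 by rewrite gr1.
have E2211 : h e2 e2 e1 e1 = h e1 e2 e1 e2 by rewrite gc1.
(* Both equations involve h e3 e1 e3 e1, with opposite coefficients I and -I, so their sum leaves
   only 2 h e1 e2 e1 e2. *)
have A := gr3 e3 e1; have B := gc3 e1 e3.
rewrite r4 z0 E2211 in A; rewrite c4 z0 E1122 in B.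
have s0 : h e1 e2 e1 e2 = 0.
  by apply: cancel2; apply: (lin (k := 1) (l := 1) A B); ring.
have r0 : h e3 e1 e3 e1 = 0.
  by apply: cancelI; rewrite -A s0; ring.
have A' := gr2 e2 e3; have B' := gc2 e3 e2.
rewrite c4 E2211 s0 in A'; rewrite r4 E1122 s0 in B'.
have t0 : h e2 e2 e2 e2 = 0.
  by apply: cancel2; apply: cancelI; apply: (lin (k := 1) (l := - 1) A' B'); ring.
have u0 : h e2 e3 e2 e3 = 0 by rewrite -A' t0; ring.
by rewrite E1122 E2211.
Qed.

Let block12 :
  [/\ h e1 e1 e1 e2 = 0, h e1 e2 e1 e1 = 0, h e2 e2 e1 e2 = 0
    & [/\ h e1 e2 e2 e2 = 0, h e2 e3 e3 e1 = 0 & h e3 e1 e2 e3 = 0]].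
Proof.
have E1211 : h e1 e2 e1 e1 = h e1 e1 e1 e2 by rewrite -r1 gc1.
have E2212 : h e2 e2 e1 e2 = h e1 e2 e2 e2 by rewrite -c1 gc1.
have E2331 : h e2 e3 e3 e1 = I * h e3 e1 e2 e3 by rewrite gc1 r3 c2.
(* With z = h e3 e1 e2 e3, [A] gives h e3 e3 e1 e2 = z and [D] gives h e3 e3 e1 e2 = -z. Once z = 0,
   [A] and [B] are independent equations in h e1 e1 e1 e2 and h e1 e2 e2 e2. *)
have A := gc2 e3 e1; have B := gc2 e1 e3; have D := gc3 e3 e2.
rewrite r4 c3 E2331 E2212 in A; rewrite c2 r1 c4 E1211 in B.
rewrite r3 c1 r4 E2212 in D.
have z0 : h e3 e1 e2 e3 = 0.
  apply: cancel2; apply: cancelI.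
  by apply: (lin (k := 1) (l := - I) D A); ring: II.
rewrite z0 in A B.
have x0 : h e1 e1 e1 e2 = 0.
  apply: cancel2; apply: cancelI.
  by apply: (lin (k := 1 + I) (l := 1 - I) A B); ring: II.
have y0 : h e1 e2 e2 e2 = 0.
  by apply: cancel2; apply: (lin (k := 1) (l := - 1) A B); rewrite x0; ring.
by rewrite E1211 E2212 E2331 z0 mulr0.
Qed.

Let block23 :
  [/\ h e1 e1 e2 e3 = 0, h e2 e3 e1 e1 = 0, h e2 e2 e2 e3 = 0
    & [/\ h e2 e3 e2 e2 = 0, h e1 e2 e3 e1 = 0 & h e3 e1 e1 e2 = 0]].
Proof.
have E2322 : h e2 e3 e2 e2 = h e2 e2 e2 e3 by rewrite -r2 gc2.
have E1231 : h e1 e2 e3 e1 = h e1 e1 e2 e3 by rewrite -r1 gc1 c2.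
have E3112 : h e3 e1 e1 e2 = - I * h e1 e1 e2 e3 by rewrite gc2 r1 c3 E1231.
have E2311 : h e2 e3 e1 e1 = h e1 e1 e2 e3 by rewrite gc1 r3 E3112; ring: II.
(* Two factors -I combine, so h e1 e1 e2 e3 equals its own negative. *)
have A := gc3 e1 e2; rewrite c1 E3112 in A.
have x0 : h e1 e1 e2 e3 = 0.
  by apply: cancel2; apply: (lin (k := 1) (l := 0) A A); ring: II.
have B := gc2 e3 e3; rewrite c2 r4 c4 E2322 E2311 x0 in B.
have y0 : h e2 e2 e2 e3 = 0.
  by apply: cancel2; apply: cancelI; apply: (lin (k := - 1) (l := 0) B B); ring.
by rewrite E2322 E1231 E3112 E2311 x0 y0 mulr0.
Qed.

Let block13 :
  [/\ h e1 e1 e3 e1 = 0, h e3 e1 e1 e1 = 0, h e2 e2 e3 e1 = 0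
    & [/\ h e3 e1 e2 e2 = 0, h e1 e2 e2 e3 = 0 & h e2 e3 e1 e2 = 0]].
Proof.
have E1223 : h e1 e2 e2 e3 = h e2 e2 e3 e1 by rewrite -c2 gc1.
(* [A] followed by [B] returns to h e2 e2 e3 e1 after two factors -I, hence with a change of
   sign. *)
have A := gc2 e2 e1; rewrite r2 c3 in A.
have B := gc3 e2 e2; rewrite c1 r2 E1223 A in B.
have y0 : h e2 e2 e3 e1 = 0.
  by apply: cancel2; apply: (lin (k := 1) (l := 0) B B); ring: II.
have D := gc1 e3 e2; rewrite c1 r3 A y0 mulr0 in D.
have y'0 := cancelI (esym D).
have E3111 : h e3 e1 e1 e1 = h e1 e1 e3 e1.
  have := gc3 e1 e1; rewrite c3 => /(mulfI _) -> //.
  by rewrite oppr_eq0.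
have K := gc3 e3 e3; rewrite r3 c4 r4 y'0 y0 E3111 in K.
have x0 : h e1 e1 e3 e1 = 0.
  by apply: cancel2; apply: cancelI; apply: (lin (k := - 1) (l := 0) K K); ring: II.
by rewrite E1223 A E3111 y0 x0 y'0 mulr0.
Qed.

(** The four relations express the remaining columns through these five. *)
Let col0 i a : h i a e1 e1 = 0 -> h i a e2 e2 = 0 -> h i a e1 e2 = 0 ->
  h i a e2 e3 = 0 -> h i a e3 e1 = 0 -> forall j b, h i a j b = 0.
Proof.
move=> H1 H2 H3 H4 H5; apply: ord3P; apply: ord3P;
  by rewrite ?c1 ?c2 ?c3 ?c4 ?H1 ?H2 ?H3 ?H4 ?H5 ?mulr0 ?subrr.
Qed.

(** The solution space has dimension at most one. The four blocks cover the 25 entries with row and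
    column among 11, 22, 12, 23, 31; the relations propagate zero first along rows, then along
    columns. *)
Lemma extremality : h e1 e1 e1 e1 = 0 -> forall i a j b, h i a j b = 0.
Proof.
move=> z0; have [a1 a2 a3 [a4 a5 a6]] := block0 z0.
have [b1 b2 b3 [b4 b5 b6]] := block12.
have [d1 d2 d3 [d4 d5 d6]] := block23.
have [f1 f2 f3 [f4 f5 f6]] := block13.
have R1 := @col0 e1 e1 z0 a1 b1 d1 f1.
have R2 := @col0 e2 e2 a2 a3 b3 d3 f3.
have R3 := @col0 e1 e2 b2 b4 a4 f5 d5.
have R4 := @col0 e2 e3 d2 d4 f6 a5 b5.
have R5 := @col0 e3 e1 f2 f4 d6 b6 a6.
apply: ord3P; apply: ord3P => j b;
  by rewrite ?r1 ?r2 ?r3 ?r4 ?R1 ?R2 ?R3 ?R4 ?R5 ?mulr0 ?subrr.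
Qed.

End Extremality.

(** * The map [omega] and its extremality among PPT maps *)

Section ExtremePPT.
Variable R : realType.
Local Notation C := R[i].
Local Notation Maps := 'End('M[C]_3).
Local Notation t := (transpose_map R).
Local Notation I := ('i%C : C).

Let II : I * I = -1. Proof. by rewrite -expr2 sqr_i. Qed.

Let conjI : ((I^*)%R) = - I.
Proof. by apply/eqP; rewrite eq_complex /= oppr0 !eqxx. Qed.

Let conjE := (conjI, rmorph0, rmorph1, rmorphN, rmorphD, rmorphB).

Definition mx3 (l : seq (seq C)) : 'M[C]_3 :=
  \matrix_(a, b) nth 0 (nth [::] l a) b.

(** The first two operators are a + b and a - b with a = diag(1,1,i) and b the swap of e_1 and e_2,
    so their sum of dyads is twice that of a plus that of b. Using a alone would give an invertible
    Kraus operator, whereas a + b and a - b are singular. *)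
Definition omega_kraus1 := mx3 [:: [:: 1; 1; 0]; [:: 1; 1; 0]; [:: 0; 0; I]].
Definition omega_kraus2 := mx3 [:: [:: 1; -1; 0]; [:: -1; 1; 0]; [:: 0; 0; I]].
Definition omega_kraus3 := mx3 [:: [:: 0; 0; 0]; [:: 0; 1 + I; 0]; [:: 0; 0; 1 + 1]].
Definition omega_kraus4 := mx3 [:: [:: 0; 0; 0]; [:: 0; 0; 1 + I]; [:: 0; 1 + I; 0]].
Definition omega_kraus5 := mx3 [:: [:: 0; 0; 1 + I]; [:: 0; 0; 0]; [:: I - 1; 0; 0]].

(* Twice the matrix C with C_{ij,ij} = 1 and C_{ij,ji} = B_{ji} for i <> j, and
   C_{ii,jj} = B_{ij}, where B = [[1,1,-i],[1,2,1],[i,1,3]] is positive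
   semidefinite of rank 2. *)
Definition omega : Maps :=
  Ad omega_kraus1 + Ad omega_kraus2 + Ad omega_kraus3 + Ad omega_kraus4
  + Ad omega_kraus5.

Lemma singular_rank (c : 'rV[C]_3) (A : 'M[C]_3) :
  c != 0 -> c *m A = 0 -> (\rank A <= 2)%N.
Proof.
by move=> c0 /mulmx0_rank_max; rewrite rank_rV c0.
Qed.

(** Each of the five Kraus operators is singular, as witnessed by an explicit left null vector
    [s]. *)
Lemma omega_SP2 : SP_cone 2 omega.
Proof.
have rk (s : seq C) (l : seq (seq C)) : (\row_(j < 3) nth 0 s j != 0) ->
    (forall b : 'I_3, \sum_(a < 3) nth 0 s a * nth 0 (nth [::] l a) b = 0) ->
    SP_cone 2 (Ad (mx3 l)).
  move=> s0 sl; apply: SP_cone_Ad; apply: (singular_rank s0).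
  apply/rowP => b; rewrite !mxE -[RHS](sl b).
  by apply: eq_bigr => a _; rewrite !mxE.
have nz (x : 'rV[C]_3) j : x 0 j = 1 -> x != 0.
  by apply: contra_eqN => /eqP ->; rewrite mxE eq_sym oner_eq0.
do 4 ?apply: SP_coneD.
- apply: (rk [:: 1; -1; 0]); first by apply: (nz _ e1); rewrite mxE.
  by apply: ord3P; rewrite !big_ord_recl big_ord0 /=; ring.
- apply: (rk [:: 1; 1; 0]); first by apply: (nz _ e1); rewrite mxE.
  by apply: ord3P; rewrite !big_ord_recl big_ord0 /=; ring.
- apply: (rk [:: 1; 0; 0]); first by apply: (nz _ e1); rewrite mxE.
  by apply: ord3P; rewrite !big_ord_recl big_ord0 /=; ring.
- apply: (rk [:: 1; 0; 0]); first by apply: (nz _ e1); rewrite mxE.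
  by apply: ord3P; rewrite !big_ord_recl big_ord0 /=; ring.
- apply: (rk [:: 0; 1; 0]); first by apply: (nz _ e2); rewrite mxE.
  by apply: ord3P; rewrite !big_ord_recl big_ord0 /=; ring.
Qed.

Lemma omegaE (i j a b : 'I_3) :
  let K (l : seq (seq C)) := nth 0 (nth [::] l a) i * ((nth 0 (nth [::] l b) j)^*)%R in
  omega (delta_mx i j) a b =
  K [:: [:: 1; 1; 0]; [:: 1; 1; 0]; [:: 0; 0; I]] +
  K [:: [:: 1; -1; 0]; [:: -1; 1; 0]; [:: 0; 0; I]] +
  K [:: [:: 0; 0; 0]; [:: 0; 1 + I; 0]; [:: 0; 0; 1 + 1]] +
  K [:: [:: 0; 0; 0]; [:: 0; 0; 1 + I]; [:: 0; 1 + I; 0]] +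
  K [:: [:: 0; 0; 1 + I]; [:: 0; 0; 0]; [:: I - 1; 0; 0]].
Proof.
by move=> K; rewrite !add_lfunE !mxE !Ad_delta !mxE.
Qed.

(** Partial transposition fixes C_{ij,ij} and exchanges C_{ij,ji} with C_{jj,ii}, both of which are
    B_{ji}. *)
Lemma omega_transpose : (omega \o t)%VF = omega.
Proof.
apply: map_eqP => i j; rewrite comp_lfunE transpose_mapE trmx_delta.
apply/matrixP => a b; rewrite !omegaE /=.
move: i j a b; do 4 apply: ord3P; rewrite /= !conjE /= ?conjI; ring: II.
Qed.

Lemma choi_mul_vecm (X : Maps) (w : 'M[C]_3) i a :
  (choi X *m vecm w) (mxtens_index (i, a)) 0
  = \sum_j \sum_b X (delta_mx i j) a b * w b j.
Proof.
rewrite mxE sum_mxtens_index; apply: eq_bigr => j _; apply: eq_bigr => b _.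
by rewrite choiE vecmE.
Qed.

Lemma dotc_vecm (A W : 'M[C]_3) :
  dotc (vecm A) (vecm W) = \sum_i \sum_a ((A a i)^*)%R * W a i.
Proof.
rewrite dotcE sum_mxtens_index; apply: eq_bigr => i _; apply: eq_bigr => a _.
by rewrite !vecmE.
Qed.

(** The first three come from the singular 2 x 2 blocks of C on the indices ij and ji, singular
    because B_{ij} has modulus one. The fourth is the null vector of B placed on the diagonal. *)
Definition omega_ker1 : 'M[C]_3 := mx3 [:: [:: 0; -1; 0]; [:: 1; 0; 0]; [:: 0; 0; 0]].
Definition omega_ker2 : 'M[C]_3 := mx3 [:: [:: 0; 0; 0]; [:: 0; 0; -1]; [:: 0; 1; 0]].
Definition omega_ker3 : 'M[C]_3 := mx3 [:: [:: 0; 0; I]; [:: 0; 0; 0]; [:: 1; 0; 0]].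
Definition omega_ker4 : 'M[C]_3 :=
  mx3 [:: [:: 1 + 2 * I; 0; 0]; [:: 0; - (1 + I); 0]; [:: 0; 0; 1]].

Lemma choi_Ad_ker (A W : 'M[C]_3) :
  dotc (vecm A) (vecm W) = 0 -> choi (Ad A) *m vecm W = 0.
Proof.
move=> AW; rewrite choi_Ad -mulmxA [X in _ *m X]mx11_scalar -/(dotc _ _) AW.
by rewrite raddf0 mulmx0.
Qed.

Lemma choi_kerD (X Y : Maps) (w : 'cV[C]_(3 * 3)) :
  choi X *m w = 0 -> choi Y *m w = 0 -> choi (X + Y) *m w = 0.
Proof.
have -> : choi (X + Y) = choi X + choi Y by exact: linearD.
by rewrite mulmxDl => -> ->; rewrite addr0.
Qed.

Lemma choi_Ad5_ker (A1 A2 A3 A4 A5 W : 'M[C]_3) :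
  dotc (vecm A1) (vecm W) = 0 -> dotc (vecm A2) (vecm W) = 0 ->
  dotc (vecm A3) (vecm W) = 0 -> dotc (vecm A4) (vecm W) = 0 ->
  dotc (vecm A5) (vecm W) = 0 ->
  choi (Ad A1 + Ad A2 + Ad A3 + Ad A4 + Ad A5) *m vecm W = 0.
Proof.
move=> W1 W2 W3 W4 W5.
apply: choi_kerD; last exact: choi_Ad_ker.
apply: choi_kerD; last exact: choi_Ad_ker.
apply: choi_kerD; last exact: choi_Ad_ker.
by apply: choi_kerD; apply: choi_Ad_ker.
Qed.

Let dotc_mx3 := (dotc_vecm, big_ord_recl, big_ord0, mxE).

Lemma omega_ker1P : choi omega *m vecm omega_ker1 = 0.
Proof.
by apply: choi_Ad5_ker; rewrite !dotc_mx3 /= !conjE /= ?conjI; ring: II.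
Qed.

Lemma omega_ker2P : choi omega *m vecm omega_ker2 = 0.
Proof.
by apply: choi_Ad5_ker; rewrite !dotc_mx3 /= !conjE /= ?conjI; ring: II.
Qed.

Lemma omega_ker3P : choi omega *m vecm omega_ker3 = 0.
Proof.
by apply: choi_Ad5_ker; rewrite !dotc_mx3 /= !conjE /= ?conjI; ring: II.
Qed.

Lemma omega_ker4P : choi omega *m vecm omega_ker4 = 0.
Proof.
by apply: choi_Ad5_ker; rewrite !dotc_mx3 /= !conjE /= ?conjI; ring: II.
Qed.

(** The values at w of the quadratic forms are nonnegative and sum to zero, so each vanishes. *)
Lemma psd_sum_ker m n (X : 'I_m -> 'M[C]_n) (w : 'cV[C]_n) :
  (forall k, psd (X k)) -> (\sum_k X k) *m w = 0 -> forall k, X k *m w = 0.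
Proof.
move=> pX Xw k; apply: psd_ker => //.
have /eqP := congr1 (dotc w) Xw.
rewrite mulmx_suml dotc_sumr [X in _ == X]/dotc mulmx0 mxE psumr_eq0.
  by move=> /allP/(_ k); rewrite mem_index_enum => /(_ isT)/eqP.
by move=> l _; apply: pX.
Qed.

Lemma col_rel_conj (J : C) h :
  col_rel J h -> (forall i a j b, h j b i a = ((h i a j b)^*)%R) ->
  col_rel ((J^*)%R) (fun i a j b => h j b i a).
Proof.
move=> hJ hh i a; have [h1 h2 h3 h4] := hJ i a.
split; rewrite !(hh i a).
- by rewrite h1.
- by rewrite h2.
- by rewrite h3 rmorphM rmorphN.
- by rewrite h4 rmorphB !rmorphM !rmorphD !rmorphM rmorph1 rmorph_nat.
Qed.

(** The Choi matrix of each summand inherits the kernel of that of [omega]; being hermitian, it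
    satisfies the conjugate relations on its columns. *)
Lemma omega_face_rel m (X : 'I_m -> Maps) c :
  (forall k, psd (choi (X k))) -> \sum_k X k = c *: omega -> forall k,
  let h i a j b := X k (delta_mx i j) a b in
  col_rel I h /\ col_rel (- I) (fun i a j b => h j b i a).
Proof.
move=> pX XE k h.
have ker w : choi omega *m vecm w = 0 -> choi (X k) *m vecm w = 0.
  move=> w0; apply: (psd_sum_ker (X := fun k => choi (X k))) => //.
  by rewrite -linear_sum XE linearZ /= -scalemxAl w0 scaler0.
have rel w : choi omega *m vecm w = 0 -> forall i a,
    \sum_j \sum_b h i a j b * w b j = 0.
  move=> /ker Xw i a; rewrite -choi_mul_vecm Xw mxE //.
have colh : col_rel I h.
  move=> i a; have K1 := rel _ omega_ker1P i a; have K2 := rel _ omega_ker2P i a.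
  have K3 := rel _ omega_ker3P i a; have K4 := rel _ omega_ker4P i a.
  rewrite !(big_ord_recl, big_ord0, mxE) /= in K1 K2 K3 K4.
  have lift1 : lift ord0 ord0 = e2 :> 'I_3 by apply: val_inj.
  have lift2 : lift ord0 (lift ord0 ord0) = e3 :> 'I_3 by apply: val_inj.
  have lift0 : ord0 = e1 :> 'I_3 by apply: val_inj.
  rewrite ?lift2 ?lift1 ?lift0 in K1 K2 K3 K4.
  split; apply/eqP; rewrite -subr_eq0; apply/eqP.
  - by rewrite -[RHS]oppr0 -K1; ring.
  - by rewrite -[RHS]oppr0 -K2; ring.
  - by rewrite -K3; ring.
  - by rewrite -K4; ring.
split=> //; rewrite -conjI; apply: col_rel_conj => // i a j b.
rewrite /h -!choiE -[in LHS](psd_hermitian (pX k)).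
by rewrite !mxE.
Qed.

Lemma col_rel_sub (J c : C) h g :
  col_rel J h -> col_rel J g -> col_rel J (fun i a j b => h i a j b - c * g i a j b).
Proof.
move=> hJ gJ i a; have [h1 h2 h3 h4] := hJ i a; have [g1 g2 g3 g4] := gJ i a.
by split; rewrite ?h1 ?h2 ?h3 ?h4 ?g1 ?g2 ?g3 ?g4 //; ring.
Qed.

Lemma omega_ppt : ppt omega.
Proof.
by split; rewrite ?omega_transpose; apply: SP_cone_cp omega_SP2.
Qed.

Lemma omega1111 : omega (delta_mx e1 e1) e1 e1 = 2.
Proof. by rewrite omegaE /= !conjE; ring. Qed.

Lemma omega_neq0 : omega != 0.
Proof.
apply/eqP => o0; have := omega1111; rewrite o0 zero_lfunE mxE => /eqP.
by rewrite eq_sym pnatr_eq0.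
Qed.

(** Since [omega] is fixed by t, the maps X k o t also decompose c omega, and the face relations
    apply to the partial transposes as well. *)
Lemma ppt_rel m (X : 'I_m -> Maps) c :
  (forall k, ppt (X k)) -> \sum_k X k = c *: omega -> forall k,
  let h i a j b := X k (delta_mx i j) a b in
  [/\ col_rel I h, col_rel (- I) (fun i a j b => h j b i a),
      col_rel I (fun i a j b => h j a i b) &
      col_rel (- I) (fun i a j b => h i b j a)].
Proof.
move=> pX XE k h.
have [r1 r2] := omega_face_rel (fun k => psd_choi (pX k).1) XE k.
have XtE : \sum_k (X k \o t)%VF = c *: omega.
  rewrite -[in RHS]omega_transpose comp_lfunZl -XE.
  apply/lfunP => Y; rewrite comp_lfunE !sum_lfunE.
  by apply: eq_bigr => l _; rewrite comp_lfunE.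
have [s1 s2] := omega_face_rel (fun k => psd_choi (pX k).2) XtE k.
have tE i j a b : (X k \o t)%VF (delta_mx i j) a b = h j a i b.
  by rewrite comp_lfunE transpose_mapE trmx_delta.
by split=> // i a; [have := s1 i a | have := s2 i a]; rewrite !tE.
Qed.

(** Allowing any nonzero c lets the conclusion be fed back in when a summand is itself decomposed
    further. *)
Lemma omega_extreme m (X : 'I_m -> Maps) c :
  (forall k, ppt (X k)) -> \sum_k X k = c *: omega -> c != 0 ->
  exists k d, d != 0 /\ X k = d *: omega.
Proof.
move=> pX XE c0.
have ray k : X k = (X k (delta_mx e1 e1) e1 e1 / 2) *: omega.
  (* The entry of [omega] in this position is 2, so X k - d omega satisfies all relations and
     vanishes there; [extremality] makes it zero. *)
  set d := _ / 2.
  have [h1 h2 h3 h4] := ppt_rel pX XE k.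
  have pO (l : 'I_1) : ppt omega by exact: omega_ppt.
  have OE : \sum_(l < 1) omega = 1 *: omega by rewrite big_ord1 scale1r.
  have [g1 g2 g3 g4] := ppt_rel pO OE ord0.
  have Z := extremality II (col_rel_sub d h1 g1) (col_rel_sub d h2 g2)
              (col_rel_sub d h3 g3) (col_rel_sub d h4 g4).
  apply: map_eqP => i j; apply/matrixP => a b.
  rewrite scale_lfunE mxE; apply/eqP; rewrite -subr_eq0; apply/eqP.
  apply: Z; rewrite omega1111 /d divfK ?subrr // pnatr_eq0 //.
case: (pickP (fun k => X k (delta_mx e1 e1) e1 e1 != 0)) => [k k0|all0].
  exists k, (X k (delta_mx e1 e1) e1 e1 / 2); split; last exact: ray.
  by rewrite mulf_neq0 // invr_eq0 pnatr_eq0.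
have /eqP : c *: omega = 0.
  rewrite -XE big1 // => k _; rewrite ray.
  by have /negbFE/eqP -> := all0 k; rewrite mul0r scale0r.
by rewrite scaler_eq0 (negPf c0) (negPf omega_neq0).
Qed.

(** The principal submatrix on the indices 11, 22, 12, 23, 31 is twice [M s], and [M s'] is the
    inverse of [M s]. *)
Lemma choi_omega_rank : (4 < \rank (choi omega))%N.
Proof.
pose f (k : 'I_5) : 'I_3 * 'I_3 :=
  nth (e1, e1) [:: (e1, e1); (e2, e2); (e1, e2); (e2, e3); (e3, e1)] k.
pose g k : 'I_(3 * 3) := mxtens_index ((f k).1, (f k).2).
pose s : seq (seq C) := [:: [:: 1; 1; 0; 0; 0]; [:: 1; 2; 0; 0; 0]; [:: 0; 0; 1; 0; 0];
              [:: 0; 0; 0; 1; 0]; [:: 0; 0; 0; 0; 1]].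
pose s' : seq (seq C) := [:: [:: 2; -1; 0; 0; 0]; [:: -1; 1; 0; 0; 0]; [:: 0; 0; 1; 0; 0];
              [:: 0; 0; 0; 1; 0]; [:: 0; 0; 0; 0; 1]].
pose M (l : seq (seq C)) : 'M[C]_5 := \matrix_(i, j) nth 0 (nth [::] l i) j.
have SE : (2 : C) *: M s = mxsub g g (choi omega).
  apply/matrixP => k l; rewrite 3!mxE choiE omegaE /f.
  case: k l => [[|[|[|[|[|k]]]]] //= _] [[|[|[|[|[|l]]]]] //= _];
    rewrite ?conjE /= ?conjI; ring: II.
have ST : M s *m M s' = 1%:M.
  apply/matrixP => k l; rewrite !mxE !big_ord_recl big_ord0 !mxE.
  case: k l => [[|[|[|[|[|k]]]]] //= _] [[|[|[|[|[|l]]]]] //= _]; rewrite /=; ring.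
have : (5 <= \rank ((2 : C) *: M s))%N.
  rewrite mxrank_scale_nz ?pnatr_eq0 //.
  by rewrite -{1}(mxrank1 C 5) -ST mxrankM_maxl.
move=> /leq_trans; apply; rewrite SE.
have -> : mxsub g g (choi omega) = rowsub g 1%:M *m choi omega *m colsub g 1%:M.
  by rewrite -mulmxA mulmx_colsub mulmx1 -mxsub_mul mul1mx.
exact: leq_trans (mxrankM_maxl _ _) (mxrankM_maxr _ _).
Qed.

Lemma choi_Ad_comp (A : 'M[C]_3) (X : Maps) :
  choi (Ad A \o X)%VF = (1%:M *t A) *m choi X *m (1%:M *t A) ^t*.
Proof.
rewrite -id_tens_Ad; apply: mxtens_eqP => i a j b.
rewrite choiE id_tensEmx comp_lfunE; congr (fun_of_matrix (Ad A _) a b).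
by apply/matrixP => c d; rewrite mxE choiE.
Qed.

End ExtremePPT.

(** * Separation of typical cones from the cone generated by the map *)

Section MappingCone.
Variable R : realType.
Local Notation C := R[i].
Local Notation Maps := 'End('M[C]_3).
Local Notation t := (transpose_map R).
Local Notation omega := (omega R).

(** Composition on the right acts on the first tensor factor, through the transpose of [A]; with
    [choi_Ad_comp] this shows that Kraus operators on either side cannot raise the Choi rank. *)
Lemma choi_comp_Ad (A : 'M[C]_3) (X : Maps) :
  choi (X \o Ad A)%VF = (A^T *t 1%:M) *m choi X *m (A^T *t 1%:M) ^t*.
Proof.
apply: mxtens_eqP => i a j b; rewrite choiE comp_lfunE.
rewrite (matrix_sum_delta (Ad A _)) linear_sum summxE.
rewrite mxE sum_mxtens_index.
under [LHS]eq_bigr => k _ do rewrite linear_sum summxE.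
rewrite exchange_big /=; apply: eq_bigr => l _.
rewrite [RHS](bigD1 b) //= [X in _ + X]big1 ?addr0; last first.
  move=> d db; rewrite [X in _ * X]mxE [X in _ * _ X]mxE tensmxE.
  by rewrite [1%:M _ _]mxE [b == d]eq_sym (negPf db) mulr0 rmorph0 mulr0.
rewrite mxE sum_mxtens_index mulr_suml; apply: eq_bigr => k _.
rewrite (bigD1 a) //= [X in _ + X]big1 ?addr0; last first.
  by move=> c ca; rewrite tensmxE mxE [1%:M _ _]mxE [a == c]eq_sym (negPf ca) mulr0 mul0r.
rewrite linearZ /= [LHS]mxE Ad_delta tensmxE choiE.
rewrite [X in _ = _ * X]mxE [X in _ = _ * _ X]mxE tensmxE !mxE !eqxx !mulr1.
by rewrite mulrAC.
Qed.

Lemma choi_rank_Ad_comp_Ad (A B : 'M[C]_3) (X : Maps) :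
  (\rank (choi (Ad A \o X \o Ad B)%VF) <= \rank (choi X))%N.
Proof.
rewrite choi_comp_Ad choi_Ad_comp.
have rk (M N Y : 'M[C]_(3 * 3)) : (\rank (M *m Y *m N) <= \rank Y)%N.
  exact: leq_trans (mxrankM_maxl _ _) (mxrankM_maxr _ _).
exact: leq_trans (rk _ _ _) (rk _ _ _).
Qed.

(** Extremality is applied three times: to the sum in the cone, to the Kraus terms of the outer map,
    and to those of the inner map. *)
Lemma omega_notin_mapping_cone (Phi : Maps) :
  ppt Phi -> (\rank (choi Phi) <= 4)%N -> ~ mapping_cone [set Phi] omega.
Proof.
move=> pPhi rPhi [n [F [G [H [FGH E]]]]].
have cF i : completely_positive (F i) by case: (FGH i).
have cH i : completely_positive (H i) by case: (FGH i).
have GE i : G i = Phi by case: (FGH i).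
rewrite -[LHS]scale1r in E.
have pi i : ppt (F i \o G i \o H i)%VF by rewrite GE; apply: ppt_comp.
have [i [c [c0 Ei]]] := omega_extreme pi (esym E) (oner_neq0 _).
rewrite GE in Ei.
have [m [A FE]] := cp_kraus (cF i).
have [p [B HE]] := cp_kraus (cH i).
have EA : \sum_j (Ad (A j) \o Phi \o H i)%VF = c *: omega.
  rewrite -Ei FE; apply/lfunP => X; rewrite !comp_lfunE !sum_lfunE.
  by apply: eq_bigr => j _; rewrite !comp_lfunE.
have pA j : ppt (Ad (A j) \o Phi \o H i)%VF := ppt_comp (@cp_Ad _ _) pPhi (cH i).
have [j [d [d0 Ej]]] := omega_extreme pA EA c0.
have EB : \sum_l (Ad (A j) \o Phi \o Ad (B l))%VF = d *: omega.
  rewrite -Ej HE; apply/lfunP => X; rewrite !comp_lfunE !sum_lfunE !linear_sum.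
  by apply: eq_bigr => l _; rewrite !comp_lfunE.
have pB l : ppt (Ad (A j) \o Phi \o Ad (B l))%VF
  := ppt_comp (@cp_Ad _ _) pPhi (@cp_Ad _ _).
have [l [e [e0 El]]] := omega_extreme pB EB d0.
have := choi_rank_Ad_comp_Ad (A j) (B l) Phi.
rewrite El linearZ /= mxrank_scale_nz // => /leq_trans/(_ rPhi).
by rewrite leqNgt choi_omega_rank.
Qed.

Lemma mem_mapping_cone (Phi : Maps) : mapping_cone [set Phi] Phi.
Proof.
exists 1, (fun=> \1%VF), (fun=> Phi), (fun=> \1%VF); split.
  by move=> _; split=> //; apply: cp_id.
by rewrite big_ord1 comp_lfun1l comp_lfun1r.
Qed.

Lemma mapping_cone_positive (Phi : Maps) :
  completely_positive Phi -> cone_of_positive_maps (mapping_cone [set Phi]).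
Proof.
move=> cPhi; split.
  move=> Theta [n [F [G [H [FGH ->]]]]]; apply: cp_positive; apply: cp_sum => i.
  have [cF -> cH] := FGH i; exact: cp_comp (cp_comp cF cPhi) cH.
move=> c Theta c0 [n [F [G [H [FGH ->]]]]].
exists n, (fun i => c *: F i), G, H; split.
  move=> i; have [cF GE cH] := FGH i; split=> // k k0.
  by apply: k_positiveZ => //; apply: cF.
by rewrite scaler_sumr; apply: eq_bigr => i _; rewrite !comp_lfunZl.
Qed.

(** Containing [SP_cone 1] is carried through the induction because a join needs the zero map on one
    side to keep [omega] from the other. Transposition preserves both alternatives. *)
Lemma typical_dichotomy (M : set Maps) : typical M ->
  SP_cone 1 `<=` M /\ (M `<=` SP_cone 1 \/ M omega).
Proof.
elim=> {M} [k k13|k k13|M _ [sM IH]|M1 M2 _ [s1 IH1] _ [s2 IH2]|M1 M2 _ [s1 IH1] _ [s2 IH2]].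
- have k0 : (0 < k)%N by case/andP: k13.
  split=> [Theta /SP_cone_cp c|]; first exact: c.
  (* [omega] is completely positive, so it lies in every [P_cone k], including k = 1. *)
  by right; apply: (SP_cone_cp (@omega_SP2 R)).
- have [k0 _] := andP k13; split=> [Theta|]; first exact: SP_cone_le.
  have [k1|k2] := leqP k 1; first by left=> Theta; apply: SP_cone_le.
  by right; apply: SP_cone_le (@omega_SP2 R).
- split.
    move=> Theta /SP1_transpose/sM mT; exists (Theta \o t)%VF => //.
    by rewrite -comp_lfunA transpose_mapK comp_lfun1r.
  case: IH => [MS|MO]; [left|right].
    by move=> _ [Theta /MS/SP1_transpose ? <-].
  by exists omega => //; rewrite omega_transpose.
- split; first by move=> Theta S; split; [apply: s1|apply: s2].
  case: IH1 => [MS|O1]; first by left=> Theta [/MS].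
  case: IH2 => [MS|O2]; first by left=> Theta [_ /MS].
  by right.
- split.
    by move=> Theta S; exists Theta; [apply: s1|exists 0; [apply/s2/SP_cone0|rewrite addr0]].
  case: IH1 => [MS1|O1]; last first.
    right; exists omega => //; exists 0; last by rewrite addr0.
    by apply/s2/SP_cone0.
  case: IH2 => [MS2|O2]; last first.
    right; exists 0; first by apply/s1/SP_cone0.
    by exists omega => //; rewrite add0r.
  by left=> _ [X /MS1 SX [Y /MS2 SY <-]]; apply: SP_coneD.
Qed.

End MappingCone.

Unset Implicit Arguments.

Theorem theorem16 (R : realType) (u v : 'I_5 -> 'cV[R[i]]_3)
    (Phi : 'End('M[R[i]]_3))
    (huv : is_orthonormal_UPB u v)
    (hPhi : choi Phi =
       1%:M - \sum_(i < 5) tensv (u i) (v i) *m (tensv (u i) (v i)) ^t* ) :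
  untypical (mapping_cone [set Phi]).
Proof.
have pPhi := upb_map_ppt huv hPhi.
split; first exact: mapping_cone_positive pPhi.1.
move=> /typical_dichotomy[_ [sub|mem]].
  exact: (upb_map_notin_SP1 huv hPhi) (sub _ (mem_mapping_cone Phi)).
exact: omega_notin_mapping_cone pPhi (upb_map_rank huv hPhi) mem.
Qed.
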